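(* Let $\sigma>0$ and $\Phi(v)=\frac{1}{1+10^{-v/\sigma}}$ for $v\in\mathbb{R}$. Consider $M\ge 2$ players with rating vector $\theta=(\theta_1,\dots,\theta_M)\in\mathbb{R}^M$ and the three-outcome (home win $\mathsf{H}$, away win $\mathsf{A}$, draw $\mathsf{D}$) model in which, for a game between home player $i_{H}$ and away player $i_{A}\neq i_{H}$ with $v=\theta_{i_{H}}-\theta_{i_{A}}$, $$\Pr\{Y=\mathsf{H}\mid\theta\}=\Phi^2(v),\qquad \Pr\{Y=\mathsf{A}\mid\theta\}=\Phi^2(-v),\qquad \Pr\{Y=\mathsf{D}\mid\theta\}=2\,\Phi(v)\,\Phi(-v).$$ Then the Elo algorithm which assigns the score $s_i=1$ to a win, $s_i=0$ to a loss and $s_i=\frac12$ to a draw implements the stochastic gradient algorithm for maximum likelihood estimation of $\theta$ in this model. That is, for every $K>0$ there is a step $\mu>0$, depending only on $K$ and $\sigma$, such that for every current rating vector $\hat\theta_n\in\mathbb{R}^M$, every pair of distinct players $(i_{H,n},i_{A,n})$ and every outcome $y_n\in\{\mathsf{H},\mathsf{A},\mathsf{D}\}$, the stochastic gradient update $$\hat\theta_{n+1}=\hat\theta_n-\mu\,\nabla_\theta L_n(\hat\theta_n),\qquad L_n(\theta)=-\log\Pr\{Y_n=y_n\mid\theta\},$$ coincides with the Elo update $$\hat\theta_{n+1,i}=\hat\theta_{n,i}+K\big[s_i-\Phi(\Delta_i)\big]\quad\text{for } i\in\{i_{H,n},i_{A,n}\},$$ with $\hat\theta_{n+1,m}=\hat\theta_{n,m}$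 for all other players $m$.
   Context: $M$ players indexed by $1,\dots,M$ play one-on-one games. At time $n$ the game is between the home player $i_{H,n}$ and the away player $i_{A,n}$, and its outcome is $y_n\in\{\mathsf{H},\mathsf{A},\mathsf{D}\}$ (home win, away win, draw). The vector $\theta=(\theta_1,\dots,\theta_M)$ collects the players' rating levels. Conditioned on $\theta$, outcomes of different games are independent, so the negative log-likelihood of the first $n$ outcomes is $J_n(\theta)=\sum_{l=1}^n L_l(\theta)$ with $L_l(\theta)=-\log\Pr\{Y_l=y_l\mid\theta\}$; the maximum likelihood estimate minimizes $J_n$. The stochastic gradient algorithm with step $\mu>0$ performs, at each time $n$, a single gradient step on the current term $L_n$ only, starting from the current estimate $\hat\theta_n$. In the Elo update, for a player $i\in\{i_{H,n},i_{A,n}\}$ with opponent $j$ (the other element of $\{i_{H,n},i_{A,n}\}$), $\Delta_i=\hat\theta_{n,i}-\hat\theta_{n,j}$, and the score is $s_i=1$ if player $i$ won the game, $s_i=0$ if player $i$ lost it, and $s_i=\frac12$ if it was a draw. $\hat\theta_{n,m}$ denotes the $m$-th component of $\hat\theta_n$. *)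

(* Defs.v *)
From HB Require Import structures.
From mathcomp Require Import all_boot all_order all_algebra.
From mathcomp Require Import all_classical all_reals all_analysis.
Import Order.TTheory GRing.Theory Num.Theory.
Import numFieldNormedType.Exports.
Set Implicit Arguments.
Unset Strict Implicit.
Unset Printing Implicit Defensive.
Local Open Scope ring_scope.

Inductive outcome := HomeWin | AwayWin | Draw.

Section Model.
Context {R : realType} {M : nat}.
Implicit Types (sigma mu K v : R) (theta : 'rV[R]_M) (iH iA i : 'I_M)
  (y : outcome).

Definition Phi sigma v : R := 1 / (1 + 10 `^ (- v / sigma)).

(* Pr{Y = y | theta} for the game in which iH receives iA. *)
Definition outcome_prob sigma iH iA y theta : R :=
  let v := theta 0 iH - theta 0 iA in
  match y with
  | HomeWin => Phi sigma v ^+ 2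
  | AwayWin => Phi sigma (- v) ^+ 2
  | Draw => 2 * Phi sigma v * Phi sigma (- v)
  end.

Definition neg_log_lik sigma iH iA y theta : R :=
  - ln (outcome_prob sigma iH iA y theta).

Definition gradient (f : 'rV[R]_M -> R) theta : 'rV[R]_M :=
  \row_m 'D_(delta_mx 0 m) f theta.

Definition sg_update sigma mu iH iA y theta : 'rV[R]_M :=
  theta - mu *: gradient (neg_log_lik sigma iH iA y) theta.

(* [opponent] and [score] are only meaningful for i = iH or i = iA. *)
Definition opponent iH iA i : 'I_M := if i == iH then iA else iH.

Definition score iH iA y i : R :=
  match y with
  | HomeWin => if i == iH then 1 else 0
  | AwayWin => if i == iA then 1 else 0
  | Draw => 1 / 2
  end.

Definition elo_update sigma K iH iA y theta : 'rV[R]_M :=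
  \row_m
    if (m == iH) || (m == iA) then
      theta 0 m +
        K * (score iH iA y m -
             Phi sigma (theta 0 m - theta 0 (opponent iH iA m)))
    else theta 0 m.

End Model.

(* Main.v *)
Require Import Defs.
From HB Require Import structures.
From mathcomp Require Import all_boot all_order all_algebra.
From mathcomp Require Import all_classical all_reals all_analysis.
From mathcomp Require Import ring.
Import Order.TTheory GRing.Theory Num.Theory.
Import numFieldNormedType.Exports.
Local Open Scope ring_scope.

(** With [c = ln 10 / sigma], the logistic curve satisfies
    [Phi' v = c * Phi v * Phi (- v)], so that each of the three outcome
    probabilities [p], as a function of the rating difference [v], satisfies
    [p' = 2 * c * (s - Phi v) * p], where [s] is the home player's Elo score.
    The log-likelihood thus has slope [2 * c * (s - Phi v)] in [v], and the
    step [mu = K / (2 * c)] turns the gradient step into the Elo update. *)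

Section Logistic.
Context {R : realType}.
Implicit Types (sigma v : R) (y : outcome).

Lemma Phi_expR sigma v :
  Phi sigma v = (1 + expR (- (ln 10 / sigma) * v))^-1.
Proof.
rewrite /Phi /powR pnatr_eq0/= div1r; congr (1 + expR _)^-1; ring.
Qed.

Lemma Phi_gt0 sigma v : 0 < Phi sigma v.
Proof. by rewrite Phi_expR invr_gt0 addr_gt0 ?expR_gt0. Qed.

(** Used to eliminate [Phi sigma (- v)], which turns the later derivative and update identities into
    algebra in [Phi sigma v] alone. *)
Lemma PhiN sigma v : Phi sigma (- v) = 1 - Phi sigma v.
Proof.
rewrite !Phi_expR mulrN expRN.
have := expR_gt0 (- (ln 10 / sigma) * v); set e := expR _ => e0.
by field; rewrite !gt_eqF ?addr_gt0 // [e + 1]addrC addr_gt0.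
Qed.

Lemma is_derive_Phi sigma v :
  is_derive v 1 (Phi sigma)
    (ln 10 / sigma * Phi sigma v * Phi sigma (- v)).
Proof.
pose a : R := - (ln 10 / sigma).
have -> : Phi sigma = fun x => (1 + expR (a * x))^-1.
  by apply/funext => x; exact: Phi_expR.
have e0 := expR_gt0 (a * v).
have ne0 : 1 + expR (a * v) != 0 by rewrite gt_eqF ?addr_gt0.
have dlin : is_derive v 1 (fun x => a * x) a.
  have -> : (fun x => a * x) = a \*: (id : R -> R) by [].
  by apply: is_derive_eq; rewrite /GRing.scale/= mulr1.
have dexp := is_derive1_comp (is_derive_expR (a * v)) dlin.
have dden : is_derive v 1 (fun x => 1 + expR (a * x)) (0 + expR (a * v) * a).
  exact: is_deriveD.
have dinv := @is_deriveV _ (fun x => 1 + expR (a * x)) _ _ _ ne0 dden.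
apply: (is_derive_eq dinv).
(* With [e] standing for [expR (a * v)], the derivative [- a * e / (1 + e)^2] splits into [- a],
   [1 / (1 + e)] and [e / (1 + e)]; the last factor is the curve at [- v]. *)
rewrite /= [a * - v]mulrN expRN /GRing.scale/= add0r -[ln 10 / sigma]opprK -/a.
move: e0 ne0; set e := expR _ => e0 ne0.
by field; rewrite [e + 1]addrC (gt_eqF e0).
Qed.

(** Isolates the dependence on the rating difference, so that the calculus is done in one real
    variable. *)
Definition outcome_prob_diff sigma y v : R :=
  match y with
  | HomeWin => Phi sigma v ^+ 2
  | AwayWin => Phi sigma (- v) ^+ 2
  | Draw => 2 * Phi sigma v * Phi sigma (- v)
  end.

Definition home_score y : R :=
  match y with HomeWin => 1 | AwayWin => 0 | Draw => 1 / 2 end.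

Lemma outcome_prob_diff_gt0 sigma y v : 0 < outcome_prob_diff sigma y v.
Proof.
by case: y => /=; rewrite ?exprn_gt0 ?mulr_gt0 ?Phi_gt0.
Qed.

Lemma is_derive_outcome_prob_diff sigma y v :
  is_derive v 1 (outcome_prob_diff sigma y)
    (2 * (ln 10 / sigma) * (home_score y - Phi sigma v)
       * outcome_prob_diff sigma y v).
Proof.
have dP := is_derive_Phi sigma v.
have dPN : is_derive v 1 (fun x => Phi sigma (- x))
    (- (ln 10 / sigma * Phi sigma v * Phi sigma (- v))).
  have -> : (fun x => Phi sigma (- x)) = (fun x => 1 - Phi sigma x).
    by apply/funext => x; exact: PhiN.
  by rewrite -[X in is_derive _ _ _ X]add0r; apply: is_deriveB.
case: y => /=.
- apply: (is_derive_eq (is_deriveX 2 dP)).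
  by rewrite /GRing.scale/= PhiN; ring.
- apply: (is_derive_eq (is_deriveX 2 dPN)).
  by rewrite /GRing.scale/= PhiN; ring.
- have -> : outcome_prob_diff sigma Draw =
      2 *: (Phi sigma * (fun x => Phi sigma (- x))).
    by apply/funext => x; rewrite /outcome_prob_diff -mulrA.
  have dD := is_deriveZ 2 (is_deriveM dP dPN).
  apply: (is_derive_eq dD).
  (* Abstracting [ln 10 / sigma] keeps [field] from asking for [sigma != 0]. *)
  by rewrite /GRing.scale/= PhiN; move: (ln 10 / sigma) => c; field.
Qed.

Lemma is_derive_ln_outcome_prob_diff sigma y v :
  is_derive v 1 (fun x => - ln (outcome_prob_diff sigma y x))
    (- (2 * (ln 10 / sigma) * (home_score y - Phi sigma v))).
Proof.
have p0 := outcome_prob_diff_gt0 sigma y v.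
have dp := is_derive_outcome_prob_diff sigma y v.
apply: (is_derive_eq (is_deriveN (is_derive1_comp (is_derive1_ln p0) dp))).
by rewrite mulrC mulfK ?gt_eqF.
Qed.

End Logistic.

Lemma differentiable_coordB {R : realType} {M : nat} (theta : 'rV[R]_M)
    (i j : 'I_M) :
  differentiable (fun t : 'rV[R]_M => t 0 i - t 0 j) theta.
Proof. by apply: differentiableB; exact: differentiable_coord. Qed.

(** The coordinate difference is linear in [t], so the difference quotient along [d] is exactly that
    of [g] along the scalar [d 0 i - d 0 j]. *)
Lemma derive_comp_coordB {R : realType} {M : nat} (g : R -> R) (dg : R)
    (theta d : 'rV[R]_M) (i j : 'I_M) :
  is_derive (theta 0 i - theta 0 j) 1 g dg ->
  'D_d (fun t : 'rV[R]_M => g (t 0 i - t 0 j)) theta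
    = (d 0 i - d 0 j) * dg.
Proof.
move=> dgP; have gd : differentiable g (theta 0 i - theta 0 j).
  by apply/derivable1_diffP; exact: ex_derive.
transitivity ('D_(d 0 i - d 0 j) g (theta 0 i - theta 0 j)).
  rewrite /derive [in LHS](_ : (fun h => _) = fun h => h^-1 *:
    ((g \o shift (theta 0 i - theta 0 j)) (h *: (d 0 i - d 0 j)) -
     g (theta 0 i - theta 0 j)))//.
  apply/funext => h /=; rewrite !mxE; congr (h^-1 *: (g _ - _)).
  by rewrite /GRing.scale/=; ring.
by rewrite deriveE// diff1E// derive1E derive_val.
Qed.

Theorem proposition1 (R : realType) (sigma : R) (hsigma : 0 < sigma)
    (K : R) (hK : 0 < K) :
  exists mu : R, 0 < mu /\
    forall (M : nat) (hM : (2 <= M)%N) (theta : 'rV[R]_M) (iH iA : 'I_M)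
      (hHA : iA != iH) (y : outcome),
      differentiable (neg_log_lik sigma iH iA y) theta /\
      sg_update sigma mu iH iA y theta = elo_update sigma K iH iA y theta.
Proof.
have ln10 : 0 < ln 10 :> R by rewrite ln_gt0 ?ltr1n.
have c_gt0 : 0 < 2 * (ln 10 / sigma) :> R by rewrite !(divr_gt0, mulr_gt0).
exists (K / (2 * (ln 10 / sigma))); split; first exact: divr_gt0.
move=> M _ theta iH iA hHA y.
have dg := is_derive_ln_outcome_prob_diff sigma y (theta 0 iH - theta 0 iA).
have fE : neg_log_lik sigma iH iA y = fun t : 'rV[R]_M =>
    - ln (outcome_prob_diff sigma y (t 0 iH - t 0 iA)).
  by apply/funext => t; case: y {dg}.
rewrite /sg_update fE; split.
  (* Differentiability ensures that the row of partial derivatives is the genuine gradient. *)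
  apply: (@differentiable_comp _ _ _ _ (fun t : 'rV[R]_M => t 0 iH - t 0 iA)
    (fun x => - ln (outcome_prob_diff sigma y x)) theta).
    exact: differentiable_coordB.
  by apply/derivable1_diffP; exact: ex_derive.
have c0 := lt0r_neq0 c_gt0.
(* Along the [m]-th basis vector the slope gets the factor [(iH == m) - (iA == m)]: 1 for the home
   player, -1 for the away player, 0 for the others. *)
apply/rowP => m; rewrite !mxE (derive_comp_coordB _ _ _ _ _ _ dg) !mxE eqxx/=.
move: (2 * (ln 10 / sigma)) c0 => c c0.
rewrite /opponent [iH == m]eq_sym [iA == m]eq_sym.
have [->|mH] := eqVneq m iH.
  rewrite eq_sym (negbTE hHA)/=.
  by case: y {dg fE} => /=;
    rewrite ?eqxx ?[iH == iA]eq_sym ?(negbTE hHA); field.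
have [->|mA] /= := eqVneq m iA; last by ring.
(* The away score is 1 minus the home score and the away expectation is 1 minus the home one, so the
   away correction is the opposite of the home correction, as the factor -1 requires. *)
rewrite -[theta 0 iA - _]opprB PhiN.
by case: y {dg fE} => /=; rewrite ?eqxx ?(negbTE hHA); field.
Qed.
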